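(* A map $f\colon X\to Y$ between fibrant simplicial sets is a weak equivalence if and only if it has the RHLP with respect to the maps $\partial\Delta^n\hookrightarrow\Delta^n$ for all $n\ge0$.
   Context: Fibrant means Kan complex; $\partial\Delta^0=\emptyset$. A map $X\to Y$ of simplicial sets has the relative-homotopy-lifting property (RHLP) with respect to a map $K\to L$ if every commutative square with top map $K\to X$, bottom map $L\to Y$, left map $K\to L$ and right map $X\to Y$ has a relative-homotopy-lifting, i.e. there is a map $L\to X$ such that the upper-left triangle commutes ($K\to L\to X$ is the given map $K\to X$) and there is a simplicial homotopy $L\times\Delta^1\to Y$ relative to $K$ (constant on $K$) from the composite $L\to X\to Y$ to the given map $L\to Y$. *)

(* Defs.v *)
From HB Require Import structures.
From mathcomp Require Import all_boot.

Set Implicit Arguments.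
Unset Strict Implicit.
Unset Printing Implicit Defensive.

(* Morphisms [m] -> [n] of the simplex category, where [n] = {0 < ... < n} is
   the ordinal type 'I_n.+1. *)
Definition monotone m n (f : {ffun 'I_m.+1 -> 'I_n.+1}) : bool :=
  [forall i : 'I_m.+1, forall j : 'I_m.+1, (i <= j) ==> (f i <= f j)].

Record shom (m n : nat) := SHom {
  shom_val :> {ffun 'I_m.+1 -> 'I_n.+1};
  shom_monotone : monotone shom_val
}.

HB.instance Definition _ m n := [isSub for @shom_val m n].
HB.instance Definition _ m n := [Equality of shom m n by <:].

Lemma monotoneP m n (f : {ffun 'I_m.+1 -> 'I_n.+1}) :
  reflect (forall i j : 'I_m.+1, i <= j -> f i <= f j) (monotone f).
Proof.
apply: (iffP forallP) => [H i j | H i].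
  by move/forallP: (H i) => /(_ j) /implyP.
by apply/forallP => j; apply/implyP; apply: H.
Qed.

Lemma shom_ext m n (s t : shom m n) : s =1 t -> s = t.
Proof. by move=> st; apply: val_inj; apply/ffunP. Qed.

Lemma shom_id_subproof n : monotone [ffun i : 'I_n.+1 => i].
Proof. by apply/monotoneP => i j; rewrite !ffunE. Qed.

Definition shom_id n : shom n n := SHom (shom_id_subproof n).

Lemma shom_comp_subproof k m n (t : shom m n) (s : shom k m) :
  monotone [ffun i => t (s i)].
Proof.
apply/monotoneP => i j ij; rewrite !ffunE.
apply: (monotoneP _ (shom_monotone t)).
exact: (monotoneP _ (shom_monotone s)).
Qed.

Definition shom_comp k m n (t : shom m n) (s : shom k m) : shom k n :=
  SHom (shom_comp_subproof t s).

Lemma shom_const_subproof m n (i : 'I_n.+1) :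
  monotone [ffun _ : 'I_m.+1 => i].
Proof. by apply/monotoneP => j k _; rewrite !ffunE. Qed.

Definition shom_const m n (i : 'I_n.+1) : shom m n :=
  SHom (shom_const_subproof m i).

Record sset := SSet {
  simp :> nat -> Type;
  act : forall m n, shom m n -> simp n -> simp m;
  act_id : forall n (x : simp n), act (shom_id n) x = x;
  act_comp : forall k m n (t : shom m n) (s : shom k m) (x : simp n),
    act (shom_comp t s) x = act s (act t x)
}.

Record smap (X Y : sset) := SMap {
  smap_fun :> forall n, X n -> Y n;
  smap_nat : forall m n (s : shom m n) (x : X n),
    @smap_fun m (act s x) = act s (@smap_fun n x)
}.

(* Equality of simplicial maps is taken pointwise. *)
Definition smap_eq (X Y : sset) (f g : smap X Y) : Prop :=
  forall n, f n =1 g n.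

Notation "f =s g" := (smap_eq f g) (at level 70, no associativity).

Lemma smap_comp_subproof (X Y Z : sset) (g : smap Y Z) (f : smap X Y) m n
    (s : shom m n) (x : X n) :
  g m (f m (act s x)) = act s (g n (f n x)).
Proof. by rewrite !smap_nat. Qed.

Definition smap_comp (X Y Z : sset) (g : smap Y Z) (f : smap X Y) : smap X Z :=
  SMap (@smap_comp_subproof X Y Z g f).

Notation "g \os f" := (smap_comp g f) (at level 50, left associativity).

Lemma smap_const_subproof (X Y : sset) (v : Y 0) m n
    (s : shom m n) (x : X n) :
  act (shom_const m ord0) v = act s (act (shom_const n ord0) v).
Proof.
rewrite -act_comp; congr act.
by apply: shom_ext => i; rewrite !ffunE.
Qed.

(* The constant map X -> Delta^0 -> Y at the vertex v. *)
Definition smap_const (X Y : sset) (v : Y 0) : smap X Y :=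
  @SMap X Y (fun n _ => act (shom_const n ord0) v)
        (@smap_const_subproof X Y v).

Lemma simplex_id_subproof n m (x : shom m n) : shom_comp x (shom_id m) = x.
Proof. by apply: shom_ext => i; rewrite !ffunE. Qed.

Lemma simplex_comp_subproof n j k m (t : shom k m) (s : shom j k)
    (x : shom m n) :
  shom_comp x (shom_comp t s) = shom_comp (shom_comp x t) s.
Proof. by apply: shom_ext => i; rewrite !ffunE. Qed.

Definition simplex (n : nat) : sset :=
  @SSet (fun m => shom m n) (fun _ _ s x => shom_comp x s)
        (@simplex_id_subproof n) (@simplex_comp_subproof n).

(* [in_faces P x]: the simplex x of Delta^n lies on the face opposite to the
   vertex i for some i satisfying P, i.e. x omits the value i. *)
Definition in_faces n (P : pred 'I_n.+1) m (x : shom m n) : bool :=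
  [exists i, P i && [forall j, x j != i]].

Lemma in_faces_comp n (P : pred 'I_n.+1) k m (s : shom k m) (x : shom m n) :
  in_faces P x -> in_faces P (shom_comp x s).
Proof.
move=> /existsP[i /andP[Pi /forallP xi]]; apply/existsP; exists i.
by rewrite Pi; apply/forallP => j; rewrite ffunE.
Qed.

Section Faces.
Variables (n : nat) (P : pred 'I_n.+1).

Let T m := {x : shom m n | in_faces P x}.

Definition faces_act k m (s : shom k m) (x : T m) : T k :=
  exist _ (shom_comp (sval x) s) (in_faces_comp s (svalP x)).

Lemma faces_id_subproof m (x : T m) : faces_act (shom_id m) x = x.
Proof. by apply: val_inj; apply: simplex_id_subproof. Qed.

Lemma faces_comp_subproof j k m (t : shom k m) (s : shom j k) (x : T m) :
  faces_act (shom_comp t s) x = faces_act s (faces_act t x).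
Proof. by apply: val_inj; apply: simplex_comp_subproof. Qed.

(* The subcomplex of Delta^n that is the union of the faces opposite to the
   vertices satisfying P. *)
Definition faces : sset := SSet faces_id_subproof faces_comp_subproof.

Definition faces_incl : smap faces (simplex n) :=
  @SMap faces (simplex n) (fun m x => sval x) (fun _ _ _ _ => erefl).

End Faces.

Definition boundary (n : nat) : sset := @faces n predT.
Definition boundary_incl (n : nat) : smap (boundary n) (simplex n) :=
  @faces_incl n predT.

Definition horn (n : nat) (k : 'I_n.+1) : sset := faces (predC1 k).
Definition horn_incl (n : nat) (k : 'I_n.+1) : smap (horn k) (simplex n) :=
  faces_incl (predC1 k).

(* Horns are only taken in dimension n.+1 >= 1. *)
Definition fibrant (X : sset) : Prop :=
  forall (n : nat) (k : 'I_n.+2) (h : smap (horn k) X),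
    exists g : smap (simplex n.+1) X, g \os horn_incl k =s h.

Section Product.
Variables X Y : sset.

Let T n := (X n * Y n)%type.

Definition sprod_act m n (s : shom m n) (z : T n) : T m :=
  (act s z.1, act s z.2).

Lemma sprod_id_subproof n (z : T n) : sprod_act (shom_id n) z = z.
Proof. by case: z => x y; rewrite /sprod_act !act_id. Qed.

Lemma sprod_comp_subproof k m n (t : shom m n) (s : shom k m) (z : T n) :
  sprod_act (shom_comp t s) z = sprod_act s (sprod_act t z).
Proof. by rewrite /sprod_act !act_comp. Qed.

Definition sprod : sset := SSet sprod_id_subproof sprod_comp_subproof.

End Product.

(* [homotopic_rel i g h]: there is a simplicial homotopy L x Delta^1 -> Y from
   g to h, constant on K along i : K -> L.  [shom_const n e] is the totally
   degenerate n-simplex of Delta^1 at the vertex e. *)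
Definition homotopic_rel (K L Y : sset) (i : smap K L) (g h : smap L Y) : Prop :=
  exists H : smap (sprod L (simplex 1)) Y,
    [/\ forall n (x : L n), H n (x, shom_const n ord0) = g n x,
        forall n (x : L n), H n (x, shom_const n ord_max) = h n x
      & forall n (x : K n) (t : simplex 1 n), H n (i n x, t) = h n (i n x)].

Definition RHLP (K L X Y : sset) (i : smap K L) (f : smap X Y) : Prop :=
  forall (a : smap K X) (b : smap L Y), f \os a =s b \os i ->
    exists l : smap L X, l \os i =s a /\ homotopic_rel i (f \os l) b.

(* For a map g compatible with the relations RA and RB, bijectivity of the map
   A / RA -> B / RB induced by g. *)
Definition bijective_on_classes (A B : Type) (RA : A -> A -> Prop)
    (RB : B -> B -> Prop) (g : A -> B) : Prop :=
  (forall a a', RB (g a) (g a') -> RA a a') /\ (forall b, exists a, RB (g a) b).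

(* The representatives of elements of pi_n (X, v): maps Delta^n -> X sending the
   boundary to v.  Two of them represent the same element when they are
   homotopic relative to the boundary. *)
Record spheroid (n : nat) (X : sset) (v : X 0) := Spheroid {
  spheroid_map :> smap (simplex n) X;
  spheroid_boundary :
    spheroid_map \os boundary_incl n =s smap_const (boundary n) v
}.

Definition spheroid_homotopic (n : nat) (X : sset) (v : X 0)
    (a b : spheroid n v) : Prop :=
  homotopic_rel (boundary_incl n) a b.

Lemma spheroid_push_subproof n (X Y : sset) (f : smap X Y) (v : X 0)
    (a : spheroid n v) :
  (f \os a) \os boundary_incl n =s smap_const (boundary n) (f 0 v).
Proof.
by move=> m x; rewrite /= -smap_nat; congr (f m _); apply: spheroid_boundary.
Qed.

Definition spheroid_push n (X Y : sset) (f : smap X Y) (v : X 0)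
    (a : spheroid n v) : spheroid n (f 0 v) :=
  Spheroid (spheroid_push_subproof f a).

Definition pi0_bijective (X Y : sset) (f : smap X Y) : Prop :=
  bijective_on_classes (@homotopic_rel _ _ X (boundary_incl 0))
    (@homotopic_rel _ _ Y (boundary_incl 0))
    (fun a : smap (simplex 0) X => f \os a).

(* For n >= 1 and fibrant X and Y, pi_n (f) is a group homomorphism, so it is an
   isomorphism exactly when it is bijective. *)
Definition pi_iso (n : nat) (X Y : sset) (f : smap X Y) (v : X 0) : Prop :=
  bijective_on_classes (@spheroid_homotopic n X v)
    (@spheroid_homotopic n Y (f 0 v)) (@spheroid_push n X Y f v).

(* The definition of weak equivalence between fibrant simplicial sets by
   simplicial homotopy groups (Goerss and Jardine, Simplicial Homotopy Theory,
   section I.7).  It is meaningful only for fibrant X and Y, for which relative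
   homotopy of maps into X or Y is an equivalence relation. *)
Definition weak_equivalence (X Y : sset) (f : smap X Y) : Prop :=
  pi0_bijective f /\ forall (n : nat) (v : X 0), 0 < n -> pi_iso n f v.

(* Main.v *)
Require Import Defs.
From mathcomp Require Import all_boot zify.

(* Everything follows from the homotopy extension property of the pair
   (Delta^n, boundary) for maps into a fibrant simplicial set.  It shows that
   homotopy relative to the boundary is the same as the existence of an
   (n+1)-simplex with two given faces and the others degenerate, and lifting the
   latter simplices along f gives injectivity on homotopy groups.  Conversely,
   contracting Delta^n to its vertex 0 carries simplices with an arbitrary fixed
   boundary to spheroids, so that a weak equivalence is bijective on homotopy
   classes of simplices with that boundary.  Given a square (a, b), fill the horn
   of a opposite to the face 0; over Y the face 0 of the filler is homotopic to
   a restricted to that face, hence also in X, and homotopy extension gives an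
   l with boundary a, which surjectivity corrects so that f l is homotopic to b. *)

Set Implicit Arguments.
Unset Strict Implicit.
Unset Printing Implicit Defensive.

(** * Faces, boundary and horns described by omitted vertices *)

Lemma shom_leq m n (x : shom m n) (i j : 'I_m.+1) : i <= j -> x i <= x j.
Proof. exact: (monotoneP _ (shom_monotone x)). Qed.

Lemma shom_eqP m n (x y : shom m n) : (forall i, x i = y i :> nat) -> x = y.
Proof. by move=> H; apply: shom_ext => i; apply: val_inj; apply: H. Qed.

(** The omitted vertex is a natural number, so that one [j] can be used in several dimensions. *)
Definition misses m n (j : nat) (x : shom m n) : bool :=
  [forall i, x i != j :> nat].

Lemma missesP m n j (x : shom m n) :
  reflect (forall i, x i <> j :> nat) (misses j x).
Proof. by apply: (iffP forallP) => H i; apply/eqP/H. Qed.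

Lemma misses_comp k m n j (x : shom m n) (s : shom k m) :
  misses j x -> misses j (shom_comp x s).
Proof. by move=> /missesP H; apply/missesP => i; rewrite ffunE. Qed.

Lemma boundaryP m n (x : shom m n) :
  reflect (exists2 j : nat, j <= n & misses j x) (in_faces predT x).
Proof.
apply: (iffP existsP) => [[i /andP[_ /forallP H]]|[j jn /missesP H]].
  exists i; first by rewrite -ltnS.
  by apply/missesP => l /val_inj E; move: (H l); rewrite E eqxx.
exists (inord j); rewrite /=; apply/forallP => i; apply/eqP => E.
by apply: (H i); rewrite E inordK.
Qed.

Lemma hornP m n (k : 'I_n.+1) (x : shom m n) :
  reflect (exists j : nat, [/\ j <= n, j <> k & misses j x])
    (in_faces (predC1 k) x).
Proof.
apply: (iffP existsP) => [[i /andP[/= ik /forallP H]]|[j [jn jk /missesP H]]].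
  exists i; split; [by rewrite -ltnS | by move/val_inj/eqP; rewrite (negPf ik) |].
  by apply/missesP => l /val_inj E; move: (H l); rewrite E eqxx.
exists (inord j); apply/andP; split.
  by apply/eqP => E; apply: jk; rewrite -E inordK.
by apply/forallP => i; apply/eqP => E; apply: (H i); rewrite E inordK.
Qed.

Lemma horn_boundary m n (k : 'I_n.+1) (x : shom m n) :
  in_faces (predC1 k) x -> in_faces predT x.
Proof. by move=> /hornP[j [jn _ H]]; apply/boundaryP; exists j. Qed.

(** * Maps between simplices, prisms and cylinders *)

Section MonotoneMaps.
Variables (m n : nat) (g : 'I_m.+1 -> 'I_n.+1).
Hypothesis g_mono : forall i j : 'I_m.+1, i <= j -> g i <= g j.

Lemma mk_shom_subproof : monotone [ffun i => g i].
Proof. by apply/monotoneP => i j ij; rewrite !ffunE; apply: g_mono. Qed.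

Definition mk_shom : shom m n := SHom mk_shom_subproof.
End MonotoneMaps.

Definition simplex_map m n (s : shom m n) : smap (simplex m) (simplex n).
Proof.
exists (fun k (x : shom k m) => shom_comp s x).
by move=> k l t x; apply: simplex_comp_subproof.
Defined.

Section PrismMaps.
Variables (n p : nat) (phi : 'I_n.+1 -> 'I_2 -> 'I_p.+1).
Hypothesis phi_mono : forall (i i' : 'I_n.+1) (s s' : 'I_2),
  i <= i' -> s <= s' -> phi i s <= phi i' s'.

Definition prism_simplex m (z : sprod (simplex n) (simplex 1) m) : shom m p.
Proof.
case: z => x t.
apply: (@mk_shom _ _ (fun i => phi ((x : shom m n) i) ((t : shom m 1) i))) => i j ij.
by apply: phi_mono; apply: shom_leq.
Defined.

(** The prism is the nerve of the poset [n] x [1], so a monotone map of posets induces a simplicial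
    map. *)
Definition prism_map : smap (sprod (simplex n) (simplex 1)) (simplex p).
Proof.
exists (fun m z => prism_simplex z).
by move=> k l s [x t]; apply: shom_ext => i; rewrite !ffunE.
Defined.

Lemma prism_mapE m (x : shom m n) (t : shom m 1) i :
  (prism_map m (x, t) : shom m p) i = phi (x i) (t i).
Proof. by rewrite ffunE. Qed.
End PrismMaps.

Definition prod_map (A B C : sset) (h : smap A B) : smap (sprod A C) (sprod B C).
Proof.
exists (fun m (z : sprod A C m) => (h m z.1, z.2)).
by move=> k l s [x t]; rewrite /= /sprod_act /= smap_nat.
Defined.

Definition cyl_end (A Y : sset) (H : smap (sprod A (simplex 1)) Y) (e : 'I_2) :
  smap A Y.
Proof.
exists (fun m x => H m (x, shom_const m e)).
move=> k l s x; rewrite -smap_nat /= /sprod_act /=; congr (H _ (_, _)).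
by apply: shom_ext => i; rewrite !ffunE.
Defined.

Definition cyl_const (A Y : sset) (g : smap A Y) : smap (sprod A (simplex 1)) Y.
Proof.
exists (fun m (z : sprod A (simplex 1) m) => g m z.1).
by move=> k l s [x t]; rewrite /= smap_nat.
Defined.

(** * Homotopy extension by filling horns in the prism *)

(* A map on the subcomplex [A] of [S] is encoded by a total function that is
   natural on [A]. *)
Definition natural_on (S X : sset) (A : forall m, S m -> bool)
    (g : forall m, S m -> X m) : Prop :=
  forall m n (s : shom m n) (y : S n), A n y -> g m (act s y) = act s (g n y).

Definition in_faces_simplex n (P : pred 'I_n.+1) m (x : shom m n)
  (hx : in_faces P x) : faces P m := exist _ x hx.

(* [r] need not be simplicial; being a left inverse of [c] it locates the
   simplices of the attached cell. *)
Lemma horn_attach (S X : sset) N (k : 'I_N.+2) (A B : forall m, S m -> bool)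
    (c : smap (simplex N.+1) S) (r : forall m, S m -> simplex N.+1 m)
    (g : forall m, S m -> X m) :
  fibrant X ->
  (forall m x, r m (c m x) = x) ->
  (forall m y, B m y -> c m (r m y) = y) ->
  (forall m x, A m (c m x) = in_faces (predC1 k) x) ->
  (forall m n (s : shom m n) y, A n y -> A m (act s y)) ->
  natural_on A g ->
  exists2 g' : forall m, S m -> X m,
    natural_on (fun m y => A m y || B m y) g'
    & forall m y, A m y -> g' m y = g m y.
Proof.
move=> hX rK cK Ac Aact gnat.
have hnat m n (s : shom m n) (z : horn k n) :
    g m (c m (sval (act s z))) = act s (g n (c n (sval z))).
  case: z => z hz /=; rewrite -gnat; last by rewrite Ac.
  by rewrite -(@smap_nat _ _ c _ _ s (z : simplex _ _)).
have [G GE] := hX N k (SMap hnat).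
exists (fun m y => if A m y then g m y else G m (r m y)); last by move=> m y ->.
move=> m n s y /orP[Ay|By]; first by rewrite Ay Aact // gnat.
case: ifPn => [Asy|nAsy]; case: ifPn => [Ay|nAy].
- exact: gnat.
(* Here [y] is outside [A] but [s] carries it into [A]: the result lies in the horn, where the
   filler [G] restricts to [g]. *)
- rewrite -[in g m _](cK _ _ By) -smap_nat /=.
  have hx : in_faces (predC1 k) (shom_comp (r n y) s).
    by rewrite -Ac; rewrite -{1}(cK _ _ By) -smap_nat in Asy.
  have /= E := GE m (in_faces_simplex hx).
  by rewrite -(smap_nat G) E.
- by rewrite Aact in nAsy.
- by rewrite -[in act s y](cK _ _ By) -!smap_nat rK.
Qed.

(* [minn n] only matters for [j > n], which is never used. *)
Lemma degen_subproof n j (l l' : 'I_n.+2) : l <= l' ->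
  (inord (minn n (l - (j < l))) : 'I_n.+1) <=
  (inord (minn n (l' - (j < l'))) : 'I_n.+1).
Proof. move=> ll; rewrite !inordK; lia. Qed.

Definition degen n (j : nat) : shom n.+1 n := mk_shom (@degen_subproof n j).

Lemma degenE n j (l : 'I_n.+2) : j <= n -> degen n j l = l - (j < l) :> nat.
Proof. move=> jn; rewrite ffunE inordK; have := ltn_ord l; lia. Qed.

Lemma threshold_subproof n j (l l' : 'I_n.+1) : l <= l' ->
  (inord (j < l) : 'I_2) <= (inord (j < l') : 'I_2).
Proof. move=> ll; rewrite !inordK; lia. Qed.

Definition threshold n (j : nat) : shom n 1 := mk_shom (@threshold_subproof n j).

Lemma thresholdE n j (l : 'I_n.+1) : threshold n j l = (j < l) :> nat.
Proof. by rewrite ffunE inordK //; case: (j < l). Qed.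

Lemma shom_comp_const k m n (i : 'I_n.+1) (s : shom k m) :
  shom_comp (shom_const m i) s = shom_const k i.
Proof. by apply: shom_ext => l; rewrite !ffunE. Qed.

Definition cylinder n : sset := sprod (simplex n) (simplex 1).

(** Vertex [l] goes to (l, 0) if l <= j and to (l - 1, 1) if l > j. *)
Definition prism_chain n (j : nat) : smap (simplex n.+1) (cylinder n).
Proof.
exists (fun m (x : shom m n.+1) =>
  (shom_comp (degen n j) x, shom_comp (threshold n.+1 j) x) : cylinder n m).
by move=> k l s x; congr pair; apply: simplex_comp_subproof.
Defined.

Lemma rank_subproof n (i i' : 'I_n.+1) (s s' : 'I_2) : i <= i' -> s <= s' ->
  (inord (i + s) : 'I_n.+2) <= (inord (i' + s') : 'I_n.+2).
Proof.
move=> ii ss; have := ltn_ord i; have := ltn_ord i'.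
by have := ltn_ord s; have := ltn_ord s' => *; rewrite !inordK; lia.
Qed.

(** The rank function of the poset [n] x [1] is a common retraction for all the maximal chains. *)
Definition rank n : smap (cylinder n) (simplex n.+1) :=
  prism_map (@rank_subproof n).

Lemma rankE n m (x : shom m n) (t : shom m 1) i :
  (rank n m (x, t) : shom m n.+1) i = x i + t i :> nat.
Proof.
rewrite prism_mapE inordK //; have := ltn_ord (x i); have := ltn_ord (t i); lia.
Qed.

(* The simplices of the j-th maximal chain
   (0,0) < ... < (j,0) < (j,1) < ... < (n,1) of [n] x [1]. *)
Definition in_prism n (j : nat) m (z : cylinder n m) : bool :=
  [forall i, ((z.1 : shom m n) i < j) ==> ((z.2 : shom m 1) i == 0 :> nat)]
  && [forall i, (j < (z.1 : shom m n) i) ==> ((z.2 : shom m 1) i == 1 :> nat)].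

Lemma in_prismP n j m (x : shom m n) (t : shom m 1) :
  reflect ((forall i, x i < j -> t i = 0 :> nat)
           /\ (forall i, j < x i -> t i = 1 :> nat))
    (in_prism j ((x, t) : cylinder n m)).
Proof.
apply: (iffP andP) => -[/= H1 H2]; split.
- by move=> i; move/forallP: H1 => /(_ i)/implyP H /H/eqP.
- by move=> i; move/forallP: H2 => /(_ i)/implyP H /H/eqP.
- by apply/forallP => i; apply/implyP => /H1/eqP.
- by apply/forallP => i; apply/implyP => /H2/eqP.
Qed.

Lemma degen_compE n j m (x : shom m n.+1) i : j <= n ->
  shom_comp (degen n j) x i = x i - (j < x i) :> nat.
Proof. by move=> jn; rewrite -degenE // [in LHS]ffunE. Qed.

Lemma threshold_compE n j m (x : shom m n) i :
  shom_comp (threshold n j) x i = (j < x i) :> nat.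
Proof. by rewrite -thresholdE [in LHS]ffunE. Qed.

Lemma rank_chain n j m (x : simplex n.+1 m) : j <= n ->
  rank n m (prism_chain n j m x) = x.
Proof.
move=> jn; apply: shom_eqP => i; rewrite rankE degen_compE // threshold_compE.
lia.
Qed.

Lemma chain_rank n j m (z : cylinder n m) : j <= n -> in_prism j z ->
  prism_chain n j m (rank n m z) = z.
Proof.
case: z => x t jn /in_prismP[H0 H1].
congr pair; apply: shom_eqP => i;
  rewrite ?degen_compE // ?threshold_compE rankE;
  have := H0 i; have := H1 i; have := ltn_ord ((t : shom m 1) i); lia.
Qed.

Lemma in_prism_cover n m (z : cylinder n m) :
  exists2 j, j <= n & in_prism j z.
Proof.
case: z => x t.
(* The last column visited at height 0. The empty maximum is 0, the right value when [t] is
   constantly 1. *)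
pose j := \max_(i < m.+1 | t i == 0 :> nat) x i.
exists j; first by apply/bigmax_leqP => i _; rewrite -ltnS.
apply/in_prismP; split => i; have ti := ltn_ord (t i); last first.
  move=> ji; apply/eqP; apply: contraTT ji => nt1.
  by rewrite -leqNgt; apply: (bigmax_sup i) => //; lia.
move=> ij; have [//|t0] := eqVneq (t i : nat) 0.
suff : j <= x i by lia.
apply/bigmax_leqP => i' t'0; apply: shom_leq; rewrite leqNgt.
by apply/negP => /ltnW/(shom_leq t); lia.
Qed.

(* The boundary, the end [e] and the maximal chains already filled in meet the
   chain [j] in a horn; the chains are filled from [j = n] down to 0 when
   [e = 0], and from [j = 0] up to [n] when [e = 1]. *)
Lemma chain_horn n (j : nat) (e : 'I_2) (Q : pred nat) m
    (x : simplex n.+1 m) (z := prism_chain n j m x) :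
  j <= n ->
  (if e == ord0 then Q =1 ltn j else Q =1 gtn j) ->
  in_faces predT z.1 || (z.2 == shom_const m e)
    || has (fun i => Q i && in_prism i z) (iota 0 n.+1)
  = in_faces (predC1 (inord (if e == ord0 then j else j.+1))) x.
Proof.
move=> jn Qj.
have z1 i : (z.1 : shom m n) i = x i - (j < x i) :> nat by apply: degen_compE.
have z2 i : (z.2 : shom m 1) i = (j < x i) :> nat by apply: threshold_compE.
have kn : (if e == ord0 then j else j.+1) < n.+2 by case: ifP; lia.
apply/idP/hornP; rewrite inordK //.
  have e2 : e = (e != ord0) :> nat by case: e {Qj kn} => -[|[|?]].
  case/orP => [/orP[/boundaryP[i im /missesP mi]|/eqP ez]|/hasP[i _ /andP[Qi iz]]].
  (* The degeneracy sends both [j] and [j.+1] to [j], so for [i = j] both are omitted; the one that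
     differs from the horn vertex is chosen. *)
  - exists (if i < j then i else if j < i then i.+1 else
      if e == ord0 then j.+1 else j); split; try by do ?case: ifP; lia.
    apply/missesP => l xl; apply: (mi l); rewrite z1; move: xl.
    by do ?case: ifP; lia.
  - exists (if e == ord0 then j.+1 else j); split; try by do ?case: ifP; lia.
    apply/missesP => l xl; move: (z2 l); rewrite ez ffunE e2; move: xl.
    by case: ifP => /=; lia.
  - exists (if e == ord0 then j.+1 else j); split; try by do ?case: ifP; lia.
    move: iz; rewrite -[z]/(z.1, z.2) => /in_prismP[i0 i1].
    apply/missesP => l xl; move: (i0 l) (i1 l) (Qi); rewrite z1 z2.
    by move: Qj xl; case: ifP => _ -> /=; lia.
case=> l [ln lk /missesP xl].
(* Faces opposite a vertex other than [j] and [j.+1] come from the boundary of the base; of these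
   two, one is the horn vertex and the other is treated last. *)
have [lj|jl] := ltnP l j.
  apply/orP; left; apply/orP; left; apply/boundaryP; exists l; first by lia.
  by apply/missesP => i; rewrite z1; have := xl i; lia.
have [j1l|lj1] := ltnP j.+1 l.
  apply/orP; left; apply/orP; left; apply/boundaryP; exists l.-1; first by lia.
  by apply/missesP => i; rewrite z1; have := xl i; lia.
have {}lE : l = (if e == ord0 then j.+1 else j) by move: lk; case: ifP; lia.
have {}xl i : x i <> (if e == ord0 then j.+1 else j) :> nat by rewrite -lE.
have [e0|e1] := eqVneq e ord0.
  move: Qj xl; rewrite {1 2}e0 eqxx => Qj xl.
  (* For [j = n] the face opposite [j.+1] is the end at 0; otherwise it is shared with chain [j.+1],
     already filled. *)
  have [jE|nj] := eqVneq j n; apply/orP; [left|right].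
    apply/orP; right; apply/eqP; apply: shom_eqP => i; rewrite z2 ffunE e0 /=.
    by have := xl i; have := ltn_ord (x i); lia.
  apply/hasP; exists j.+1; first by rewrite mem_iota; lia.
  rewrite Qj /= ltnSn -[z]/(z.1, z.2); apply/in_prismP.
  by split=> i; rewrite z1 z2; have := xl i; lia.
have eE : e = ord_max by case: e e1 {kn Qj lk lE xl} => -[|[|?]] // *; apply: val_inj.
move: Qj xl; rewrite (negPf e1) => Qj xl.
have [jE|nj] := eqVneq j 0; apply/orP; [left|right].
  apply/orP; right; apply/eqP; apply: shom_eqP => i; rewrite z2 ffunE eE /=.
  by have := xl i; lia.
apply/hasP; exists j.-1; first by rewrite mem_iota; lia.
rewrite Qj -[z]/(z.1, z.2) /=; apply/andP; split; first by lia.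
by apply/in_prismP; split=> i; rewrite z1 z2; have := xl i; lia.
Qed.

(** The chains are attached to the boundary and the end [e] one horn at a time; after [n.+1] of them
    the cylinder is exhausted, because every simplex lies in some chain. *)
Lemma homotopy_extension (X : sset) n (e : 'I_2) (g : smap (simplex n) X)
    (K : forall m, cylinder n m -> X m) :
  fibrant X ->
  natural_on (fun m (z : cylinder n m) => in_faces predT z.1) K ->
  (forall m (x : simplex n m), in_faces predT x ->
     K m (x, shom_const m e) = g m x) ->
  exists2 H : smap (cylinder n) X,
    cyl_end H e =s g
    & forall m (x : simplex n m) t, in_faces predT x -> H m (x, t) = K m (x, t).
Proof.
move=> hX Knat Kg.
pose A0 m (z : cylinder n m) := in_faces predT z.1 || (z.2 == shom_const m e).
(* The chains filled after [d] stages: the last [d] if [e] is 0, the first [d] otherwise. *)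
pose Q d i := if e == ord0 then n.+1 - d <= i else i < d.
pose A d m (z : cylinder n m) :=
  A0 m z || has (fun i => Q d i && in_prism i z) (iota 0 n.+1).
pose g0 m (z : cylinder n m) := if in_faces predT z.1 then K m z else g m z.1.
have A0act m k (s : shom m k) (z : cylinder n k) : A0 k z -> A0 m (act s z).
  case: z => x t /orP[/= xb|/eqP /= ->].
    by apply/orP; left; apply: in_faces_comp.
  by apply/orP; right; rewrite /= shom_comp_const.
have prism_act i m k (s : shom m k) (z : cylinder n k) :
    in_prism i z -> in_prism i (act s z).
  case: z => x t /in_prismP[t0 t1]; apply/in_prismP.
  by split=> l; rewrite !ffunE; [apply: t0 | apply: t1].
have ext d : d <= n.+1 -> exists2 g' : forall m, cylinder n m -> X m,
    natural_on (A d) g' & forall m z, A0 m z -> g' m z = g0 m z.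
  elim: d => [_|d IH dn].
    exists g0 => // m k s z.
    have -> : A 0 k z = A0 k z.
      rewrite /A; apply/orb_idr => /hasP[i]; rewrite mem_iota /Q => iN /andP[+ _].
      by case: ifP; lia.
    case: z => x t Az; rewrite /g0 /=.
    have [xb|xb] := boolP (in_faces predT x).
      by rewrite in_faces_comp // Knat.
    move: Az; rewrite /A0 /= (negPf xb) /= => /eqP ->.
    rewrite -smap_nat; case: ifP => // xsb.
    by rewrite /sprod_act /= shom_comp_const Kg.
  have [g' g'nat g'0] := IH (ltnW dn).
  pose j := if e == ord0 then n - d else d.
  have jn : j <= n by rewrite /j; case: ifP; lia.
  have Qj : if e == ord0 then Q d =1 ltn j else Q d =1 gtn j.
    by rewrite /Q /j; case: (e == ord0) => i //=; rewrite subSn.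
  have [|||||g'' g''nat g''E] := @horn_attach (cylinder n) X n
    (inord (if e == ord0 then j else j.+1)) (A d)
    (fun m z => in_prism j z) (prism_chain n j) (rank n) g' hX.
  - by move=> m x; apply: rank_chain.
  - by move=> m z; apply: chain_rank.
  - by move=> m x; apply: chain_horn.
  - move=> m k s z /orP[/A0act Az|/hasP[i iN /andP[Qi iz]]].
      by rewrite /A Az.
    by apply/orP; right; apply/hasP; exists i; rewrite // Qi prism_act.
  - exact: g'nat.
  exists g'' => [m k s z Az|m z Az]; last by rewrite g''E ?g'0 // /A Az.
  apply: g''nat; case/orP: Az => [Az|/hasP[i iN /andP[Qi iz]]].
    by rewrite /A Az.
  have [ij|ij] := eqVneq i j; first by rewrite -ij iz orbT.
  apply/orP; left; apply/orP; right; apply/hasP; exists i => //; rewrite iz andbT.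
  by move: Qi ij; rewrite /Q /j; case: ifP; lia.
have [g' g'nat g'0] := ext _ (leqnn _).
have Hnat m k (s : shom m k) (z : cylinder n k) : g' m (act s z) = act s (g' k z).
  apply: g'nat; apply/orP; right; have [j jn jz] := in_prism_cover z.
  apply/hasP; exists j; first by rewrite mem_iota.
  by rewrite jz andbT /Q subnn; case: ifP.
exists (SMap Hnat) => [m x|m x t xb] /=; rewrite g'0 /A0 /= ?eqxx ?orbT //.
  by rewrite /g0 /=; case: ifP => // /Kg.
  by rewrite /g0 /= xb.
by rewrite xb.
Qed.

(** * Cofaces, and homotopies glued from a face and a horn *)

Lemma delta_subproof n (j : 'I_n.+2) (i i' : 'I_n.+1) :
  i <= i' -> lift j i <= lift j i'.
Proof. by rewrite /= leq_bump2. Qed.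

Definition delta n (j : 'I_n.+2) : shom n n.+1 := mk_shom (@delta_subproof n j).

Lemma delta_compE n (j : 'I_n.+2) m (x : shom m n) i :
  shom_comp (delta j) x i = (j <= x i) + x i :> nat.
Proof. by rewrite !ffunE. Qed.

Lemma delta_degen n (j : 'I_n.+2) m (x : shom m n.+1) : j <= n ->
  misses j x -> shom_comp (delta j) (shom_comp (degen n j) x) = x.
Proof.
move=> jn /missesP xj; apply: shom_eqP => i; rewrite delta_compE degen_compE //.
by have := xj i; lia.
Qed.

Lemma misses_delta n (j : 'I_n.+2) m (x : shom m n) :
  misses j (shom_comp (delta j) x).
Proof.
by apply/missesP => i; rewrite !ffunE /= => /esym/eqP; rewrite (negPf (neq_bump _ _)).
Qed.

Lemma delta0_horn n m (x : shom m n) : in_faces predT x ->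
  in_faces (predC1 ord0) (shom_comp (delta (ord0 : 'I_n.+2)) x).
Proof.
move=> /boundaryP[j jn /missesP xj]; apply/hornP; exists j.+1; split=> //.
by apply/missesP => i; rewrite delta_compE /= add1n => -[/xj].
Qed.

Lemma degen_boundary n (j : 'I_n.+2) m (x : shom m n.+1) : j <= n ->
  misses j x -> in_faces (predC1 j) x ->
  in_faces predT (shom_comp (degen n j) x).
Proof.
move=> jn /missesP xj /hornP[l [ln lj /missesP xl]]; apply/boundaryP.
exists (l - (j < l)); first by lia.
apply/missesP => i; rewrite degen_compE //; have := xj i; have := xl i; lia.
Qed.

Lemma boundary_cases n (j : 'I_n.+1) m (x : shom m n) :
  in_faces predT x -> misses j x \/ in_faces (predC1 j) x.
Proof.
move=> /boundaryP[l ln xl]; have [->|lj] := eqVneq (j : nat) l; [by left|right].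
by apply/hornP; exists l; split=> //; apply/eqP; rewrite eq_sym.
Qed.

Lemma misses_boundary n (j : 'I_n.+1) m (x : shom m n) :
  misses j x -> in_faces predT x.
Proof. by move=> xj; apply/boundaryP; exists j; rewrite // -ltnS. Qed.

(** The boundary is the union of the face opposite [j], identified with [simplex n] by the
    degeneracy, and the horn at [j]. Agreement on the overlap makes [H] and [G] one homotopy on the
    boundary, which extends. *)
Lemma glued_extension (X : sset) n (j : 'I_n.+2) (e : 'I_2)
    (g : smap (simplex n.+1) X) (H : smap (cylinder n) X)
    (G : forall m, cylinder n.+1 m -> X m) :
  fibrant X -> j <= n ->
  natural_on (fun m (z : cylinder n.+1 m) => in_faces (predC1 j) z.1) G ->
  (forall m (x : simplex n.+1 m) t, misses j x -> in_faces (predC1 j) x ->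
     H m (shom_comp (degen n j) x, t) = G m (x, t)) ->
  (forall m (x : simplex n.+1 m), misses j x ->
     H m (shom_comp (degen n j) x, shom_const m e) = g m x) ->
  (forall m (x : simplex n.+1 m), in_faces (predC1 j) x ->
     G m (x, shom_const m e) = g m x) ->
  exists L : smap (cylinder n.+1) X,
    [/\ cyl_end L e =s g,
        forall m (x : simplex n.+1 m) t, misses j x ->
          L m (x, t) = H m (shom_comp (degen n j) x, t)
      & forall m (x : simplex n.+1 m) t, in_faces (predC1 j) x ->
          L m (x, t) = G m (x, t)].
Proof.
move=> hX jn Gnat HG Hg Gg.
pose K m (z : cylinder n.+1 m) :=
  if misses j (z.1 : shom m n.+1) then H m (shom_comp (degen n j) z.1, z.2)
  else G m z.
have KG m (x : simplex n.+1 m) t : in_faces (predC1 j) x -> K m (x, t) = G m (x, t).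
  by rewrite /K /=; case: ifP => // xj; apply: HG.
have [|m x xb|L Lg LK] := @homotopy_extension X n.+1 e g K hX.
- move=> m k s [x t] /= xb; have [xj|xh] := boundary_cases j xb.
    by rewrite /K /= misses_comp // xj -smap_nat /= /sprod_act /= simplex_comp_subproof.
  by rewrite (KG _ x) // -Gnat // -KG // in_faces_comp.
- have [xj|xh] := boundary_cases j xb; last by rewrite KG ?Gg.
  by rewrite /K /= xj Hg.
exists L; split=> // m x t xj.
  by rewrite LK ?(misses_boundary xj) // /K /= xj.
by rewrite LK ?(horn_boundary xj) // KG.
Qed.

(** * Combinatorial homotopy and relative homotopy *)

(* Combinatorial homotopy: an (n+1)-simplex with last two faces [a'] and [a],
   the others being degenerate. *)
Definition simplex_homotopic n (X : sset) (a a' : smap (simplex n) X) : Prop :=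
  exists k : smap (simplex n.+1) X,
    forall m (x : simplex n.+1 m), in_faces predT x ->
      k m x = if misses n x then a' m (shom_comp (degen n n) x)
              else a m (shom_comp (degen n n) x).

Definition same_boundary n (X : sset) (a a' : smap (simplex n) X) : Prop :=
  a \os boundary_incl n =s a' \os boundary_incl n.

Lemma same_boundaryP n (X : sset) (a a' : smap (simplex n) X) :
  same_boundary a a' <->
  forall m (x : simplex n m), in_faces predT x -> a m x = a' m x.
Proof.
split=> [E m x xb|E m [x xb]]; last exact: E.
exact: (E m (in_faces_simplex xb)).
Qed.

Lemma simplex_homotopic_ext n (X : sset) (a a' b b' : smap (simplex n) X) :
  a =s b -> a' =s b' -> simplex_homotopic a a' -> simplex_homotopic b b'.
Proof. by move=> ab ab' [k kE]; exists k => m x /kE ->; rewrite ab ab'. Qed.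

Lemma simplex_homotopic_refl n (X : sset) (a a' : smap (simplex n) X) :
  a =s a' -> simplex_homotopic a a'.
Proof.
move=> aa'; exists (a \os simplex_map (degen n n)) => m x _ /=.
by case: ifP => // _; apply: aa'.
Qed.

(* Extending the homotopies [H0] and [H1] on the last two faces of an
   (n+1)-simplex, and a degenerate one on the other faces, moves the simplex at
   one end to a simplex at the other end. *)
Lemma simplex_homotopic_transport n (X : sset) (H0 H1 : smap (cylinder n) X)
    (e e' : 'I_2) :
  fibrant X ->
  (forall m (x : simplex n m) t, in_faces predT x -> H0 m (x, t) = H1 m (x, t)) ->
  simplex_homotopic (cyl_end H0 e) (cyl_end H1 e) ->
  simplex_homotopic (cyl_end H0 e') (cyl_end H1 e').
Proof.
move=> hX H01 [k kE]; pose j : 'I_n.+2 := inord n.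
have jE : j = n :> nat by rewrite inordK.
have jn : j <= n by rewrite jE.
have mj m (x : shom m n.+1) : misses n x = misses j x by rewrite jE.
pose G m (z : cylinder n.+1 m) : X m := H0 m (shom_comp (degen n n) z.1, z.2).
have HG m (x : simplex n.+1 m) t : misses j x -> in_faces (predC1 j) x ->
    H1 m (shom_comp (degen n j) x, t) = G m (x, t).
  move=> xj xh; have := degen_boundary jn xj xh.
  by rewrite /G jE => xb; rewrite H01.
have [|||L [_ Lm Lh]] := @glued_extension X n j e k H1 G hX jn _ HG.
- move=> m l s [x t] _; rewrite /G -smap_nat /= /sprod_act /=.
  by rewrite simplex_comp_subproof.
- move=> m x xj; rewrite kE; last exact: misses_boundary xj.
  by rewrite mj xj jE.
- move=> m x xh; rewrite kE; last exact: horn_boundary xh.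
  by rewrite mj; case: ifP => // xj; rewrite -HG // jE.
exists (cyl_end L e') => m x xb; rewrite mj /=.
case: ifPn => xj; first by rewrite Lm // jE.
by rewrite Lh ?/G ?jE //; case: (boundary_cases j xb) => // xj'; rewrite xj' in xj.
Qed.

Lemma homotopic_rel_same_boundary n (X : sset) (a a' : smap (simplex n) X) :
  homotopic_rel (boundary_incl n) a a' -> same_boundary a a'.
Proof. by move=> [H [H0 H1 Hb]] m x; rewrite /= -H0 Hb. Qed.

(** At the end 0 the given homotopy and the constant one at [a] coincide; transport carries the
    trivial combinatorial homotopy there to the end 1. *)
Lemma homotopic_rel_simplex n (X : sset) (a a' : smap (simplex n) X) :
  fibrant X -> homotopic_rel (boundary_incl n) a a' -> simplex_homotopic a a'.
Proof.
move=> hX aa'; have [H [H0 H1 Hb]] := aa'.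
have /same_boundaryP ab := homotopic_rel_same_boundary aa'.
apply: (@simplex_homotopic_ext _ _ (cyl_end (cyl_const a) ord_max) (cyl_end H ord_max)).
- by [].
- exact: H1.
apply: (@simplex_homotopic_transport _ _ _ _ ord0) => //.
  by move=> m x t xb; rewrite (Hb m (in_faces_simplex xb)) /= ab.
by apply: simplex_homotopic_refl => m x; rewrite /= H0.
Qed.

Lemma last_edge_subproof n (i i' : 'I_n.+1) (s s' : 'I_2) :
  i <= i' -> s <= s' ->
  (inord (i + (i == n :> nat) * s) : 'I_n.+2)
    <= (inord (i' + (i' == n :> nat) * s') : 'I_n.+2).
Proof.
move=> ii ss; have := ltn_ord i; have := ltn_ord i'.
have := ltn_ord s; have := ltn_ord s' => *.
by rewrite !inordK; case: eqP => *; try case: eqP => *; lia.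
Qed.

(** Only the vertex (n, 1) is moved, to [n.+1]. The end 0 is thus the face opposite [n.+1], and the
    end 1 the face opposite [n]. *)
Definition last_edge n : smap (cylinder n) (simplex n.+1) :=
  prism_map (@last_edge_subproof n).

Lemma last_edgeE n m (x : shom m n) (t : shom m 1) i :
  (last_edge n m (x, t) : shom m n.+1) i = x i + (x i == n :> nat) * t i :> nat.
Proof.
rewrite prism_mapE inordK //; have := ltn_ord (x i); have := ltn_ord (t i).
by case: eqP; lia.
Qed.

Lemma simplex_homotopic_rel n (X : sset) (a a' : smap (simplex n) X) :
  same_boundary a a' -> simplex_homotopic a a' ->
  homotopic_rel (boundary_incl n) a a'.
Proof.
move=> /same_boundaryP ab [k kE].
have dl m (x : shom m n) (t : shom m 1) :
    shom_comp (degen n n) (last_edge n m (x, t)) = x.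
  apply: shom_eqP => i; rewrite degen_compE // last_edgeE.
  by have := ltn_ord (x i); have := ltn_ord (t i); case: eqP; lia.
have lb m (x : shom m n) (t : shom m 1) : in_faces predT x ->
    in_faces predT (last_edge n m (x, t) : shom m n.+1).
  move=> /boundaryP[j jn /missesP xj]; apply/boundaryP; exists j; first by lia.
  apply/missesP => i; rewrite last_edgeE; have := xj i.
  by have := ltn_ord (x i); case: eqP; lia.
exists (k \os last_edge n); split=> m.
- move=> x; rewrite -[LHS]/(k m (last_edge n m (x, shom_const m ord0))) kE; last first.
    apply/boundaryP; exists n.+1 => //; apply/missesP => i.
    by rewrite last_edgeE ffunE /=; have := ltn_ord (x i); lia.
  (* If the simplex also omits [n], then [x] lies in the boundary, where [a] and [a'] agree. *)
  rewrite dl; case: ifP => // /missesP xn; rewrite ab //.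
  apply/boundaryP; exists n => //; apply/missesP => i.
  by have := xn i; rewrite last_edgeE ffunE /=; lia.
- move=> x; rewrite -[LHS]/(k m (last_edge n m (x, shom_const m ord_max))).
  have xn : misses n (last_edge n m (x, shom_const m ord_max) : shom m n.+1).
    by apply/missesP => i; rewrite last_edgeE ffunE /=; case: eqP; lia.
  by rewrite kE ?xn ?dl //; apply/boundaryP; exists n.
move=> [x xb] t; rewrite -[LHS]/(k m (last_edge n m (x, t))) kE ?lb // dl.
by case: ifP => // _; rewrite ab.
Qed.

(** * Relative lifting implies weak equivalence *)

Lemma same_boundary_push n (X Y : sset) (f : smap X Y) (a a' : smap (simplex n) X) :
  same_boundary a a' -> same_boundary (f \os a) (f \os a').
Proof. by move=> aa' m x /=; congr (f m _); apply: aa'. Qed.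

(** The boundary that a combinatorial homotopy from [a] to [a'] must have lies over the boundary of
    [k]; a lift of this square has that boundary exactly. *)
Lemma RHLP_reflects_homotopy n (X Y : sset) (f : smap X Y)
    (a a' : smap (simplex n) X) :
  RHLP (boundary_incl n.+1) f -> same_boundary a a' ->
  simplex_homotopic (f \os a) (f \os a') -> simplex_homotopic a a'.
Proof.
move=> flift /same_boundaryP ab [k kE]; pose j : 'I_n.+2 := inord n.
have jE : j = n :> nat by rewrite inordK.
have jn : j <= n by rewrite jE.
have mj m (x : shom m n.+1) : misses n x = misses j x by rewrite jE.
pose B m (z : boundary n.+1 m) : X m :=
  if misses n (sval z : shom m n.+1) then a' m (shom_comp (degen n n) (sval z))
  else a m (shom_comp (degen n n) (sval z)).
have Bnat m l (s : shom m l) (z : boundary n.+1 l) : B m (act s z) = act s (B l z).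
  case: z => x xb; rewrite /B /=; case: ifPn => xsj; case: ifPn => xj.
  - by rewrite -smap_nat /= simplex_comp_subproof.
  (* The simplex is off the face opposite [n] but [s] carries it into that face, hence into its
     boundary, where [a] and [a'] agree. *)
  - have xh : in_faces (predC1 j) x.
      by case: (boundary_cases j xb) => // xj'; rewrite mj xj' in xj.
    rewrite mj in xsj; have := degen_boundary jn xsj (in_faces_comp s xh).
    by rewrite jE => /ab <-; rewrite -smap_nat /= simplex_comp_subproof.
  - by rewrite misses_comp in xsj.
  - by rewrite -smap_nat /= simplex_comp_subproof.
have [|l [lB _]] := flift (SMap Bnat) k.
  by move=> m [x xb]; rewrite /= kE // /B /=; case: ifP.
by exists l => m x xb; have /= -> := lB m (in_faces_simplex xb).
Qed.

Lemma boundary0_empty m : boundary 0 m -> False.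
Proof.
case=> x /boundaryP[j j0 /missesP/(_ ord0)].
by have := ltn_ord ((x : shom m 0) ord0); lia.
Qed.

Definition boundary0_map (X : sset) : smap (boundary 0) X.
Proof.
exists (fun m z => match boundary0_empty z with end).
by move=> m n s z; case: (boundary0_empty z).
Defined.

(** Surjectivity in dimension [n] comes from lifting in dimension [n], injectivity from lifting in
    dimension [n.+1]. *)
Lemma RHLP_weak_equivalence (X Y : sset) (f : smap X Y) :
  fibrant Y -> (forall n, RHLP (boundary_incl n) f) -> weak_equivalence f.
Proof.
move=> hY flift.
have inj n (a a' : smap (simplex n) X) : same_boundary a a' ->
    homotopic_rel (boundary_incl n) (f \os a) (f \os a') ->
    homotopic_rel (boundary_incl n) a a'.
  move=> aa' faa'; apply: simplex_homotopic_rel => //.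
  by apply: (RHLP_reflects_homotopy (flift _)) => //; apply: homotopic_rel_simplex.
split; [split | move=> n v _; split].
- by move=> a a'; apply: inj => m z; case: (boundary0_empty z).
- move=> b.
  have [|l [_ lb]] := flift 0 (boundary0_map X) b; last by exists l.
  by move=> m z; case: (boundary0_empty z).
- by move=> a a'; apply: inj => m x; rewrite !spheroid_boundary.
- move=> b; have [|l [lv lb]] := flift n (smap_const _ v) b.
    by move=> m x; rewrite spheroid_boundary /= smap_nat.
  by exists (Spheroid lv).
Qed.

(** * Contraction of a simplex to its vertex 0 *)

Lemma cone_subproof n (i i' : 'I_n.+1) (s s' : 'I_2) : i <= i' -> s <= s' ->
  (inord (s * i) : 'I_n.+1) <= (inord (s' * i') : 'I_n.+1).
Proof.
move=> ii ss; have := ltn_ord i; have := ltn_ord i'.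
have := ltn_ord s; have := ltn_ord s' => *.
by rewrite !inordK; nia.
Qed.

Definition cone n : smap (cylinder n) (simplex n) := prism_map (@cone_subproof n).

Lemma coneE n m (x : shom m n) (t : shom m 1) i :
  (cone n m (x, t) : shom m n) i = t i * x i :> nat.
Proof.
by rewrite prism_mapE inordK //; have := ltn_ord (x i); have := ltn_ord (t i); nia.
Qed.

Lemma cone0 n m (x : shom m n) : cone n m (x, shom_const m ord0) = shom_const m ord0.
Proof. by apply: shom_eqP => i; rewrite coneE !ffunE. Qed.

Lemma cone1 n m (x : shom m n) : cone n m (x, shom_const m ord_max) = x.
Proof. by apply: shom_eqP => i; rewrite coneE !ffunE mul1n. Qed.

Lemma cone_end n (X : sset) (a : smap (simplex n) X) :
  cyl_end (a \os cone n) ord_max =s a.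
Proof.
by move=> m x; rewrite -[LHS]/(a m (cone n m (x, shom_const m ord_max))) cone1.
Qed.

(** A face opposite a nonzero vertex contains the vertex 0, so the contraction preserves it. *)
Lemma cone_horn n m (x : shom m n) (t : shom m 1) :
  in_faces (predC1 ord0) x -> in_faces (predC1 ord0) (cone n m (x, t)).
Proof.
move=> /hornP[j [jn j0 /missesP xj]]; apply/hornP; exists j; split=> //.
apply/missesP => i; rewrite coneE; have := xj i; have := ltn_ord (t i).
by case: (t i : nat) => [|[|?]] //; rewrite ?mul1n // mul0n => _ _; move/esym.
Qed.

Definition first_vertex n (X : sset) (a : smap (simplex n) X) : X 0 :=
  a 0 (shom_const 0 ord0).

Lemma first_vertexE n (X : sset) (a : smap (simplex n) X) m :
  a m (shom_const m ord0) = act (shom_const m ord0) (first_vertex a).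
Proof. by rewrite -smap_nat /= shom_comp_const. Qed.

(** This moves [a] along the track that another homotopy [C] describes on the boundary. *)
Lemma extend_along n (X : sset) (e : 'I_2) (C : smap (cylinder n) X)
    (a : smap (simplex n) X) :
  fibrant X -> same_boundary (cyl_end C e) a ->
  exists2 H : smap (cylinder n) X, cyl_end H e =s a
    & forall m (x : simplex n m) t, in_faces predT x -> C m (x, t) = H m (x, t).
Proof.
move=> hX /same_boundaryP Ca.
have [|//|H Ha HC] := @homotopy_extension X n e a (fun m z => C m z) hX.
  by move=> m k s z _; rewrite smap_nat.
by exists H => // m x t xb; rewrite HC.
Qed.

(** On the boundary [H] follows the contraction of [a], which starts constant at the first
    vertex. *)
Lemma cone_start_spheroid n (X : sset) (a : smap (simplex n) X)
    (H : smap (cylinder n) X) :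
  (forall m (x : simplex n m) t, in_faces predT x ->
     (a \os cone n) m (x, t) = H m (x, t)) ->
  exists s : spheroid n (first_vertex a), cyl_end H ord0 = s.
Proof.
move=> aH.
have sb : cyl_end H ord0 \os boundary_incl n
    =s smap_const (boundary n) (first_vertex a).
  move=> m [x xb]; rewrite /= -aH // -[LHS]/(a m (cone n m (x, shom_const m ord0))).
  by rewrite cone0 first_vertexE.
by exists (Spheroid sb).
Qed.

(** * Weak equivalences on simplices with a fixed boundary *)

Section WeakEquivalence.
Variables (X Y : sset) (f : smap X Y).
Hypotheses (hX : fibrant X) (hY : fibrant Y) (hf : weak_equivalence f).

(** Moving [a] and [a'] along the same contraction gives spheroids. Transport in [Y] makes their
    images homotopic, injectivity makes the spheroids homotopic, and transport in [X] leads back. *)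
Lemma weak_equivalence_reflects n (a a' : smap (simplex n) X) :
  same_boundary a a' -> simplex_homotopic (f \os a) (f \os a') ->
  simplex_homotopic a a'.
Proof.
move=> aa' faa'; have [[inj0 _] pi_f] := hf.
case: n => [|n] in a a' aa' faa' *.
  apply: homotopic_rel_simplex => //; apply: inj0.
  by apply: simplex_homotopic_rel => //; apply: same_boundary_push.
pose C := a \os cone n.+1.
have Ca : cyl_end C ord_max =s a := cone_end a.
have [|H Ha' CH] := @extend_along _ _ ord_max C a' hX.
  by move=> m x; rewrite -aa'; apply: Ca.
have [s Cs] := @cone_start_spheroid _ _ a C (fun _ _ _ _ => erefl).
have [s' Hs'] := cone_start_spheroid CH.
have [inj _] := pi_f n.+1 (first_vertex a) isT.
apply: (simplex_homotopic_ext Ca Ha').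
apply: (@simplex_homotopic_transport _ _ C H ord0 ord_max hX CH); rewrite Cs Hs'.
apply: homotopic_rel_simplex => //; apply: inj; rewrite /spheroid_homotopic /= -Cs -Hs'.
apply: simplex_homotopic_rel.
  by apply: same_boundary_push; rewrite Cs Hs' => m x; rewrite !spheroid_boundary.
apply: (@simplex_homotopic_transport _ _ (f \os C) (f \os H) ord_max ord0 hY).
  by move=> m x t xb; rewrite /= -CH.
apply: simplex_homotopic_ext faa' => m x; congr (f m _); symmetry; first exact: Ca.
exact: Ha'.
Qed.

(** The simplex [b] is moved along the image of the contraction of [a] to a spheroid, which
    surjectivity lifts up to homotopy to [s]; moving [s] back over [X] gives [l]. *)
Lemma weak_equivalence_lifts n (a : smap (simplex n) X) (b : smap (simplex n) Y) :
  0 < n -> same_boundary (f \os a) b ->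
  exists2 l : smap (simplex n) X, same_boundary l a
    & homotopic_rel (boundary_incl n) (f \os l) b.
Proof.
move=> n0 ab; have [_ pi_f] := hf; pose C := a \os cone n.
have Ca : cyl_end C ord_max =s a := cone_end a.
have [|H Hb CH] := @extend_along _ _ ord_max (f \os C) b hY.
  by move=> m x; rewrite -ab; congr (f m _); apply: Ca.
have [t Ht] := @cone_start_spheroid _ _ (f \os a) H CH.
have [_ surj] := pi_f n (first_vertex a) n0.
have [s st] := surj t.
(* The extension now starts from the end 0, so the contraction is run backwards from [s] to a
   simplex with the boundary of [a]. *)
have [|L Ls CL] := @extend_along _ _ ord0 C s hX.
  have [s0 Cs0] := @cone_start_spheroid _ _ a C (fun _ _ _ _ => erefl).
  by move=> m x; rewrite Cs0 !spheroid_boundary.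
have La : same_boundary (cyl_end L ord_max) a.
  by apply/same_boundaryP => m x xb; rewrite -Ca; symmetry; apply: CL.
exists (cyl_end L ord_max) => //; apply: simplex_homotopic_rel.
  by move=> m x; rewrite -ab /=; congr (f m _); apply: La.
apply: (@simplex_homotopic_ext _ _ (cyl_end (f \os L) ord_max)
  (cyl_end H ord_max)) => //.
apply: (@simplex_homotopic_transport _ _ _ _ ord0) => //.
  by move=> m x u xb; rewrite -CH //; congr (f m _); symmetry; apply: CL.
apply: (@simplex_homotopic_ext _ _ (f \os s) (cyl_end H ord0)).
- by move=> m x; congr (f m _); symmetry; apply: Ls.
- by [].
by rewrite Ht; apply: homotopic_rel_simplex.
Qed.
End WeakEquivalence.

(** * Weak equivalence implies relative lifting *)

Theorem proposition4p1 (X Y : sset) (f : smap X Y)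
    (hX : fibrant X) (hY : fibrant Y) :
  weak_equivalence f <-> forall n : nat, RHLP (boundary_incl n) f.
Proof.
split; last exact: RHLP_weak_equivalence.
move=> hf [|n] a b fab.
  (* With empty boundary, lifting is surjectivity on path components. *)
  have [[_ surj] _] := hf; have [l lb] := surj b.
  by exists l; split=> // m z; case: (boundary0_empty z).
(* Any filler of [a] suffices: its image has the boundary of [b], and [weak_equivalence_lifts]
   corrects it. *)
suff [l la] : exists l : smap (simplex n.+1) X, l \os boundary_incl n.+1 =s a.
  have [|l' l'l l'b] := @weak_equivalence_lifts _ _ f hX hY hf n.+1 l b isT.
    by move=> m z; rewrite -fab; congr (f m _); apply: la.
  by exists l'; split=> // m z; rewrite l'l la.
pose horn_to_boundary m (z : horn (ord0 : 'I_n.+2) m) : boundary n.+1 m :=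
  in_faces_simplex (horn_boundary (svalP z)).
have hnat m k (s : shom m k) (z : horn (ord0 : 'I_n.+2) k) :
    a m (horn_to_boundary m (act s z)) = act s (a k (horn_to_boundary k z)).
  by rewrite -smap_nat; congr (a m _); apply: val_inj.
have [g ga] := hX n ord0 (SMap hnat).
have gaE m (x : shom m n.+1) (xh : in_faces (predC1 ord0) x)
    (xb : in_faces predT x) : g m x = a m (in_faces_simplex xb).
  have /= -> := ga m (in_faces_simplex xh).
  by congr (a m _); apply: val_inj.
pose d : shom n n.+1 := delta ord0.
pose dface m (x : simplex n m) : boundary n.+1 m :=
  in_faces_simplex (misses_boundary (misses_delta (ord0 : 'I_n.+2) x)).
have a0nat m k (s : shom m k) (x : simplex n k) :
    a m (dface m (act s x)) = act s (a k (dface k x)).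
  rewrite -smap_nat; congr (a m _); apply: val_inj.
  exact: simplex_comp_subproof.
pose a0 : smap (simplex n) X := SMap a0nat.
pose g0 := g \os simplex_map d.
have ga0 : same_boundary g0 a0.
  apply/same_boundaryP => m x xb.
  exact: (gaE m _ (delta0_horn xb)).
(* Both [f \os g] and [b] extend [f \os a] on the horn. Their contractions, restricted to the face
   0, agree on its boundary and at the start, so transport compares the ends. *)
have fg0 : simplex_homotopic (f \os g0) (f \os a0).
  pose H (u : smap (simplex n.+1) Y) :=
    u \os cone n.+1 \os prod_map (simplex 1) (simplex_map d).
  apply: (@simplex_homotopic_ext _ _ (cyl_end (H (f \os g)) ord_max)
    (cyl_end (H b) ord_max)).
  - by move=> m x; apply: (cone_end (f \os g)).
  - by move=> m x; apply: etrans (esym (fab m (dface m x))); apply: (cone_end b).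
  apply: (@simplex_homotopic_transport _ _ _ _ ord0) => //.
    move=> m x t xb; have xh := cone_horn t (delta0_horn xb).
    have := fab m (in_faces_simplex (horn_boundary xh)).
    by rewrite /= -gaE.
  apply: simplex_homotopic_refl => m x.
  rewrite -[LHS]/(f m (g m (cone n.+1 m (shom_comp d x, shom_const m ord0)))).
  rewrite -[RHS]/(b m (cone n.+1 m (shom_comp d x, shom_const m ord0))) cone0.
  have vh : in_faces (predC1 (ord0 : 'I_n.+2)) (shom_const m ord0).
    (* The vertex 0 lies on the face opposite 1, which exists since the dimension is positive. *)
    by apply/hornP; exists 1; split=> //; apply/missesP => i; rewrite ffunE.
  rewrite (gaE _ _ vh (horn_boundary vh)).
  exact: (fab m (in_faces_simplex (horn_boundary vh))).
have := weak_equivalence_reflects hX hY hf ga0 fg0.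
move/(simplex_homotopic_rel ga0) => [H [H0 H1 Hb]].
have a0_degen m (x : shom m n.+1) (xb : in_faces predT x) : misses 0 x ->
    a0 m (shom_comp (degen n (ord0 : 'I_n.+2)) x) = a m (in_faces_simplex xb).
  by move=> x0; congr (a m _); apply: val_inj; apply: delta_degen.
(* Starting at [g], the homotopy is constant on the horn and is [H] on the face 0; its other end
   therefore has boundary [a]. *)
have [||||L [_ L0 Lh]] := @glued_extension X n ord0 ord0 g H
    (fun m z => g m z.1) hX isT.
- by move=> m k s z _; rewrite -smap_nat.
- move=> m x t x0 xh; have xb := degen_boundary (isT : (ord0 : 'I_n.+2) <= n) x0 xh.
  rewrite (Hb m (in_faces_simplex xb)) (gaE m x xh (horn_boundary xh)).
  exact: a0_degen.
- move=> m x x0; rewrite H0.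
  rewrite -[LHS]/(g m (shom_comp d (shom_comp (degen n (ord0 : 'I_n.+2)) x))).
  by rewrite delta_degen.
- by [].
exists (cyl_end L ord_max) => m [x xb].
rewrite -[LHS]/(L m (x, shom_const m ord_max)).
have [x0|xh] := boundary_cases ord0 xb.
  by rewrite L0 // H1; apply: a0_degen.
by rewrite Lh //; apply: gaE.
Qed.
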